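(* Let $\phi$ and $B$ satisfy the slowly varying moment class assumption stated in the context. Fix $\beta\in(0,\tfrac12)$ and let $\xi_n=\log(1/\beta)/n$. For every sequence of positive reals $(\Delta_n)_{n\ge1}$ and every sequence of measurable estimators $\mu_n:\mathbb R^n\to\mathbb R$ with $\beta_n(\mu_n;\Delta_n)\le\beta$ for all $n$, $$\Delta_n\;\ge\;m^{-1}(\xi_n)\,(1-o(1)),\qquad n\to\infty,$$ i.e. $\liminf_{n\to\infty}\Delta_n/m^{-1}(\xi_n)\ge1$.
   Context: Slowly varying moment class assumption: $\phi:\mathbb R\to[0,\infty)$ is even, continuous, non-decreasing on $[0,\infty)$, $\phi(x)/|x|\to\infty$ as $|x|\to\infty$, $\phi(0)<B$, and (A1) there is $x_0>0$ with $\phi(x)=0$ for $|x|\le x_0$; (A2) with $\Lambda(x)=\phi(x)/|x|$, there exist $x_\infty>1$, $\Lambda_0>0$ and a continuously differentiable $\eta:[x_\infty,\infty)\to(0,\infty)$ such that $\Lambda(x)=\Lambda_0\exp\{\int_{x_\infty}^x\frac{\eta(u)}{u}\,du\}$ for $x\ge x_\infty$, where (i) $\eta(x)\to0$; (ii) $\int_{x_\infty}^\infty\frac{\eta(u)}{u}\,du=\infty$; (iii) $x\eta'(x)/\eta(x)\to0$ as $x\to\infty$. Then $\Lambda$ is a strictly increasing continuous bijection of $[x_\infty,\infty)$ onto $[\Lambda(x_\infty),\infty)$, with inverse $\Lambda^{-1}$. For $\Delta>0$ with $B/\Delta\ge\Lambda(x_\infty)$ set $m(\Delta)=\Delta/\Lambda^{-1}(B/\Delta)$;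 $m$ is continuous, strictly increasing, and $m(\Delta)\to0$ as $\Delta\downarrow0$, so $m^{-1}$ is defined on a right neighborhood of $0$ (and $m^{-1}(\xi_n)$ for all large $n$). For $\mu\in\mathbb R$, $\mathcal C_\mu$ is the set of Borel probability measures $P$ on $\mathbb R$ with $\int x\,dP=\mu$ and $\int\phi(x-\mu)\,dP\le B$. The worst-case confidence level of an estimator $\mu_n=\mu_n(X_1,\dots,X_n)$ is $$\beta_n(\mu_n;\Delta)=\max\Bigl\{\sup_{\mu\in\mathbb R,\,P_\mu\in\mathcal C_\mu}P_\mu[\mu_n>\mu+\Delta],\ \sup_{\mu\in\mathbb R,\,P_\mu\in\mathcal C_\mu}P_\mu[\mu_n<\mu-\Delta]\Bigr\},$$ with $X_1,\dots,X_n$ i.i.d. of law $P_\mu$ under $P_\mu$. *)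

(* Defs.v *)
(* The real line is an arbitrary [R : realType] of MathComp-Analysis. *)
From HB Require Import structures.
From mathcomp Require Export all_boot all_order all_algebra.
From mathcomp Require Export all_classical all_reals all_analysis.

Set Implicit Arguments.
Unset Strict Implicit.
Unset Printing Implicit Defensive.

Import Order.TTheory GRing.Theory Num.Theory.
Export numFieldNormedType.Exports.
Local Open Scope classical_set_scope.
Local Open Scope ring_scope.

(** * The moment class *)

(* The difference quotient is restricted to [D], so that the derivative at an
   endpoint of an interval [D] is the one-sided one. *)
Definition derivative_on (R : realType) (D : set R) (f df : R -> R) :=
  forall x, D x -> (f y - f x) / (y - x) @[y --> within D x^'] --> df x.

Definition Lam (R : realType) (phi : R -> R) (x : R) : R := phi x / `|x|.

(* [x_inf] is a parameter because [m_fun] below depends on it;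
   [deta] is the derivative of [eta]. *)
Record slowly_varying_moment (R : realType) (phi : R -> R) (B x_inf : R) :
    Prop := SlowlyVaryingMoment {
  svm_ge0 : forall x, 0 <= phi x;
  svm_even : forall x, phi (- x) = phi x;
  svm_continuous : continuous phi;
  svm_nondecreasing : forall x y : R, 0 <= x -> x <= y -> phi x <= phi y;
  svm_superlinear_pinfty : phi x / `|x| @[x --> +oo] --> +oo;
  svm_superlinear_ninfty : phi x / `|x| @[x --> -oo] --> +oo;
  svm_B : phi 0 < B;
  svm_flat : exists2 x0 : R, 0 < x0 & forall x, `|x| <= x0 -> phi x = 0;
  svm_x_inf : 1 < x_inf;
  svm_Karamata : exists (Lam0 : R) (eta deta : R -> R),
    [/\ 0 < Lam0,
        forall x, x_inf <= x -> 0 < eta x,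
        derivative_on `[x_inf, +oo[ eta deta
          /\ {within `[x_inf, +oo[, continuous deta},
        forall x, x_inf <= x ->
          Lam phi x = Lam0 * expR
            (\int[lebesgue_measure]_(u in `[x_inf, x]) (eta u / u)) &
        [/\ eta x @[x --> +oo] --> 0,
            (\int[lebesgue_measure]_(u in `[x_inf, +oo[) (eta u / u)%:E
              = +oo)%E &
            x * deta x / eta x @[x --> +oo] --> 0]]
}.

(* ['pinv_dflt A f] is the inverse of [f : A -> f @` A], extended by [dflt]
   outside [f @` A]. *)
Definition Lam_inv (R : realType) (phi : R -> R) (x_inf : R) : R -> R :=
  'pinv_(fun=> 0) `[x_inf, +oo[ (Lam phi).

Definition m_dom (R : realType) (phi : R -> R) (B x_inf : R) : set R :=
  [set Delta | 0 < Delta /\ Lam phi x_inf <= B / Delta].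

Definition m_fun (R : realType) (phi : R -> R) (B x_inf Delta : R) : R :=
  Delta / Lam_inv phi x_inf (B / Delta).

Definition m_inv (R : realType) (phi : R -> R) (B x_inf : R) : R -> R :=
  'pinv_(fun=> 0) (m_dom phi B x_inf) (m_fun phi B x_inf).

Definition moment_class (R : realType) (phi : R -> R) (B mu : R)
    (P : probability (measurableTypeR R) R) : Prop :=
  [/\ P.-integrable setT (fun x => x%:E),
      (\int[P]_x x%:E = mu%:E)%E &
      (\int[P]_x (phi (x - mu))%:E <= B%:E)%E].

(** * Samples and worst-case confidence level *)

Section iid_law.
Context d (T : measurableType d) (R : realType) (P : probability T R).

Definition tcons n (p : T * n.-tuple T) : n.+1.-tuple T :=
  [the n.+1.-tuple T of p.1 :: p.2].

Lemma measurable_tcons n : measurable_fun setT (@tcons n).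
Proof. exact: measurable_cons. Qed.

HB.instance Definition _ n :=
  isMeasurableFun.Build _ _ _ _ (@tcons n) (@measurable_tcons n).

(* The [n]-fold product of [P], i.e. the joint law of [n] independent variables
   of law [P]: [P^(n+1)] is the image of [P \x P^n] under [tcons]. *)
Fixpoint iid_law n : probability (n.-tuple T) R :=
  if n is k.+1 then distribution (P \x iid_law k)%E (@tcons k)
  else dirac [tuple].

Lemma iid_law_rect n (A : 'I_n -> set T) : (forall i, measurable (A i)) ->
  iid_law n [set t | forall i, A i (tnth t i)] = (\prod_(i < n) P (A i))%E.
Proof.
elim: n A => [|n IH] A mA.
  rewrite big_ord0 /= diracE mem_set//= => -[].
  by [].
rewrite big_ord_recl /= /distribution /pushforward /=.
rewrite -IH; last by move=> i; exact: mA.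
rewrite -product_measure1E//; last first.
  have -> : [set t : n.-tuple T | forall i, A (lift ord0 i) (tnth t i)] =
      \bigcap_(i in [set: 'I_n]) ((@tnth _ T)^~ i @^-1` A (lift ord0 i)).
    by apply/seteqP; split => t /= h i; [move=> _|]; apply: h.
  apply: fin_bigcap_measurable => // i _.
  by rewrite -[X in measurable X]setTI; exact: measurable_tnth.
congr (_ _); apply/seteqP; split => -[x t] /=.
  move=> h; split=> [|i]; first by have := h ord0.
  by have := h (lift ord0 i); rewrite /tcons /= tnthS.
move=> [h0 h] i; have [->//|] := eqVneq i ord0.
by rewrite eq_sym => /unlift_some[j -> _]; rewrite /tcons /= tnthS.
Qed.

End iid_law.

Definition confidence_level (R : realType) (phi : R -> R) (B : R) (n : nat)
    (est : n.-tuple (measurableTypeR R) -> R) (Delta : R) : \bar R :=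
  maxe
    (ereal_sup [set p | exists (mu : R) P, moment_class phi B mu P /\
       p = iid_law P n [set x | mu + Delta < est x]])
    (ereal_sup [set p | exists (mu : R) P, moment_class phi B mu P /\
       p = iid_law P n [set x | est x < mu - Delta]]).

(* Main.v *)
(* Let M = m^{-1}(xi_n) and L = Lambda^{-1}(B / M), so that M = xi_n L and
   phi(L) = B / xi_n.  If Delta_n < (1 - e) M, put p = (1 - e) xi_n and consider
   the laws (1 - p) delta_0 + p delta_L and (1 - p) delta_0 + p delta_{-L}.
   Their means are +- p L = +- (1 - e) M and, since phi vanishes near 0, their
   central phi-moments are at most p phi(L) <= B.  The sample (0, ..., 0) has
   probability (1 - p)^n under both, and whatever the estimator returns on it is
   off by more than Delta_n for one of the two laws.  Hence
   (1 - p)^n <= beta = exp (- n xi_n), which fails for large n because xi_n tends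
   to 0 and p = (1 - e) xi_n. *)
From HB Require Import structures.
Require Import Defs.
From mathcomp Require Import ring lra measurable_realfun.

Set Implicit Arguments.
Unset Strict Implicit.
Unset Printing Implicit Defensive.

Import Order.TTheory GRing.Theory Num.Theory.
Local Open Scope classical_set_scope.
Local Open Scope ring_scope.

(** * Continuity, intermediate values and integrals on a ray *)

Lemma derivative_on_continuous (R : realType) (D : set R) (f df : R -> R) :
  derivative_on D f df -> {within D, continuous f}.
Proof.
move=> Dfdf; apply/subspace_continuousP => x Dx.
have quotM : (f y - f x) / (y - x) * (y - x) @[y --> within D x^'] --> 0.
  rewrite -(mulr0 (df x)); apply: cvgM; first exact: Dfdf.
  rewrite -[X in _ --> X](subrr x); apply: cvgB; last exact: cvg_cst.
  have dnbhsx : x^' --> x by exact: cvg_within.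
  by apply: cvg_trans dnbhsx; exact: cvg_within.
apply/cvgrPdist_lt => e e0.
have /cvgrPdist_lt/(_ e e0) := quotM.
rewrite !near_withinE; apply: filterS => y quot_lt Dy.
have [->|yx] := eqVneq y x; first by rewrite subrr normr0.
move: (quot_lt yx Dy).
by rewrite sub0r normrN divfK ?subr_eq0// distrC.
Qed.

Lemma IVT_ray (R : realType) (f : R -> R) (a v : R) :
  {within `[a, +oo[, continuous f} -> f x @[x --> +oo] --> +oo -> f a <= v ->
  exists2 c, a <= c & f c = v.
Proof.
move=> fC foo fav.
have [b [ab vb]] : exists b, a <= b /\ v <= f b.
  have : \forall x \near +oo, a <= x /\ v <= f x.
    apply: filterI; first exact: nbhs_pinfty_ge (num_real a).
    by move/cvgryPge : foo; apply.
  by move/filter_ex.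
have fCab : {within `[a, b], continuous f}.
  by apply: continuous_subspaceW fC => x /=; rewrite !in_itv/= => /andP[->].
have [|c] := IVT ab fCab (v := v).
  by rewrite ge_min fav/= le_max vb orbT.
by rewrite in_itv/= => /andP[ac _] <-; exists c.
Qed.

(** The difference is the integral over []x, y]], which is at least [y - x] times the minimum of [g]
    on [[x, y]]; that minimum is attained, hence positive. *)
Lemma ltr_Rintegral_itv (R : realType) (g : R -> R) (a x y : R) :
  a <= x -> x < y -> {within `[a, y], continuous g} ->
  (forall u, a <= u -> 0 < g u) ->
  \int[lebesgue_measure]_(u in `[a, x]) g u <
  \int[lebesgue_measure]_(u in `[a, y]) g u.
Proof.
move=> ax xy gC g_gt0.
have gI : lebesgue_measure.-integrable `[a, y] (EFin \o g).
  by apply: continuous_compact_integrable gC; exact: segment_compact.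
rewrite -subr_gt0 Rintegral_itvB//; last by rewrite bnd_simp ltW.
have sub : `[x, y]%classic `<=` `[a, y]%classic.
  by move=> u /=; rewrite !in_itv/= => /andP[xu ->]; rewrite (le_trans ax xu).
have [c cxy gmin] := EVT_min (ltW xy) (continuous_subspaceW sub gC).
have gc0 : 0 < g c.
  by apply: g_gt0; move: cxy; rewrite in_itv/= => /andP[xc _]; apply: le_trans xc.
have sub' : `]x, y]%classic `<=` `[x, y]%classic.
  by move=> u /=; rewrite !in_itv/= => /andP[/ltW -> ->].
have lenE : lebesgue_measure `]x, y]%classic = (y - x)%:E.
  by rewrite lebesgue_measure_itv/= lte_fin xy.
apply: (@lt_le_trans _ _ (\int[lebesgue_measure]_(u in `]x, y]) cst (g c) u)).
  by rewrite Rintegral_cst// [fine _](congr1 fine lenE)/= mulr_gt0// subr_gt0.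
apply: le_Rintegral => //.
- have cI : lebesgue_measure.-integrable `[x, y] (EFin \o cst (g c)).
    apply: continuous_compact_integrable; first exact: segment_compact.
    by apply: continuous_subspaceT => u; exact: cvg_cst.
  exact: integrableS cI.
- by apply: integrableS gI => //; exact: subset_trans sub.
- by move=> u /sub' uxy; apply: gmin.
Qed.

(** * Inverting [Lam] and [m_fun] *)

Section moment.
Context (R : realType) (phi : R -> R) (B x_inf : R).
Context (svm : slowly_varying_moment phi B x_inf).

Lemma svm_B_gt0 : 0 < B.
Proof. exact: le_lt_trans (svm_ge0 svm 0) (svm_B svm). Qed.

Lemma x_inf_gt0 : 0 < x_inf.
Proof. exact: lt_trans (svm_x_inf svm). Qed.

(** The integrand [eta u / u] of the Karamata representation is positive and continuous, so the
    exponent increases strictly. *)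
Lemma Lam_increasing : {in `[x_inf, +oo[ &, {homo Lam phi : x y / x < y}}.
Proof.
have [Lam0 [eta [deta [Lam0_gt0 eta_gt0 [etaD _] LamE _]]]] := svm_Karamata svm.
have etaC := derivative_on_continuous etaD.
move=> x y; rewrite !in_itv/= !andbT => ax ay xy.
rewrite !LamE// ltr_pM2l// ltr_expR; apply: ltr_Rintegral_itv => //; last first.
  by move=> u au; rewrite divr_gt0 ?eta_gt0// (lt_le_trans x_inf_gt0).
have sub : `[x_inf, y]%classic `<=` `[x_inf, +oo[%classic.
  by move=> u /=; rewrite !in_itv/= => /andP[->].
have := continuous_subspaceW sub etaC.
move=> /subspace_continuousP etaCy; apply/subspace_continuousP => u uxy.
apply: cvgM; first exact: etaCy.
apply: cvgV; last by apply: cvg_within.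
move: uxy => /=; rewrite in_itv/= => /andP[au _].
by rewrite gt_eqF// (lt_le_trans x_inf_gt0).
Qed.

Lemma Lam_inj : {in `[x_inf, +oo[%classic &, injective (Lam phi)}.
Proof.
move=> x y; rewrite !inE/= => xI yI Lxy.
have [xy|yx|//] := ltgtP x y.
- by have := Lam_increasing xI yI xy; rewrite Lxy ltxx.
- by have := Lam_increasing yI xI yx; rewrite Lxy ltxx.
Qed.

Lemma Lam_continuous : {within `[x_inf, +oo[, continuous (Lam phi)}.
Proof.
apply/subspace_continuousP => x; rewrite /= in_itv/= andbT => ax.
apply: cvg_within_filter; apply: cvgM; first exact: svm_continuous svm x.
apply: cvgV; last exact: cvg_norm.
by rewrite normr_eq0 gt_eqF// (lt_le_trans x_inf_gt0).
Qed.

Lemma svm_cvgy : phi x @[x --> +oo] --> +oo.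
Proof.
apply: ger_cvgy (svm_superlinear_pinfty svm).
near=> x; have x1 : 1 <= x by near: x; apply: nbhs_pinfty_ge; exact: num_real.
have x0 : 0 < x by apply: lt_le_trans x1.
by rewrite gtr0_norm// ler_pdivrMr// ler_peMr// (svm_ge0 svm).
Unshelve. all: by end_near. Qed.

Lemma Lam_invK : {in `[x_inf, +oo[%classic, cancel (Lam phi) (Lam_inv phi x_inf)}.
Proof. exact: pinvKV Lam_inj. Qed.

(* On [m_dom], writing [L] for [Lam_inv phi x_inf (B / M)], one has
   [m_fun M = M / L = B / phi L]; so inverting [m_fun] amounts to solving
   [phi L = B / xi]. *)
Lemma m_invP (xi : R) : 0 < xi -> phi x_inf <= B / xi ->
  let M := m_inv phi B x_inf xi in
  exists2 L, x_inf <= L & [/\ 0 < M, M = xi * L & phi L = B / xi].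
Proof.
move=> xi0 xiB M; have B0 := svm_B_gt0; have x0 := x_inf_gt0.
(* [pinvK] applies only on the image of [m_fun]. The preimage of [xi] exhibited here is [xi * L],
   where [phi L = B / xi]. *)
have m_surj : (m_fun phi B x_inf @` m_dom phi B x_inf) xi.
  have [L xL phiL] : exists2 L, x_inf <= L & phi L = B / xi.
    apply: IVT_ray svm_cvgy xiB; apply: continuous_subspaceT.
    exact: svm_continuous svm.
  have L0 : 0 < L := lt_le_trans x0 xL.
  have LamL : B / (xi * L) = Lam phi L.
    by rewrite /Lam gtr0_norm// phiL invfM mulrA.
  exists (xi * L).
    split; first exact: mulr_gt0.
    rewrite LamL; move: xL; rewrite le_eqVlt => /predU1P[->//|xL].
    by rewrite ltW// Lam_increasing// in_itv/= andbT// ltW.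
  rewrite /m_fun LamL Lam_invK ?mulfK ?gt_eqF//.
  by rewrite inE/= in_itv/= xL.
have mM : m_fun phi B x_inf M = xi by apply: pinvK; rewrite inE.
have [M0 MB] : m_dom phi B x_inf M.
  apply: (surjpinv_image_sub (A := m_dom phi B x_inf)
    (B := m_fun phi B x_inf @` m_dom phi B x_inf)); last by exists xi.
  by move=> y.
(* [M] is a chosen preimage of [xi], not yet identified with the one built above, so [L] is
   recovered from [M] itself. *)
have [L xL LamL] : exists2 L, x_inf <= L & Lam phi L = B / M.
  exact: IVT_ray Lam_continuous (svm_superlinear_pinfty svm) MB.
have L0 : 0 < L := lt_le_trans x0 xL.
have ML : M / L = xi.
  by rewrite -mM /m_fun -LamL Lam_invK// inE/= in_itv/= xL.
exists L => //; split=> //; first by rewrite -ML divfK ?gt_eqF.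
have : phi L / L = B / M by rewrite -LamL /Lam gtr0_norm.
by rewrite -ML invf_div mulrCA => <-; rewrite mulrC divfK ?gt_eqF.
Qed.

(** With [L] as in [m_invP], [M = B / Lam phi L]; a small [xi] makes [phi L = B / xi] large, hence
    [L] and then [Lam phi L] large. This later places the mean of the two-point law where [phi]
    vanishes. *)
Lemma m_inv_eventually_le (e : R) : 0 < e ->
  exists2 d, 0 < d & forall xi, 0 < xi < d -> phi x_inf <= B / xi /\
    m_inv phi B x_inf xi <= e.
Proof.
move=> e0; have B0 := svm_B_gt0; have x0 := x_inf_gt0.
have /cvgryPge Lamy := svm_superlinear_pinfty svm.
have [K [xK LamK]] : exists K, x_inf <= K /\
    forall y, K <= y -> B / e <= Lam phi y.
  have [A [_ AP]] := Lamy (B / e).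
  exists (Num.max x_inf (A + 1)); rewrite le_max lexx; split=> // y.
  by rewrite ge_max => /andP[_ Ay]; apply: AP; lra.
have K0 : 0 < K := lt_le_trans x0 xK.
(* Below this threshold [phi K < B / xi = phi L], which forces [K <= L] by monotonicity. *)
exists (B / (phi K + 1)).
  by rewrite divr_gt0// ltr_wpDl// (svm_ge0 svm).
move=> xi /andP[xi0 xid].
have phiK : phi K < B / xi.
  have pK : 0 < phi K + 1 by rewrite ltr_wpDl// (svm_ge0 svm).
  rewrite ltr_pdivlMr// mulrC; move: xid; rewrite ltr_pdivlMr//; lra.
have xiB : phi x_inf <= B / xi.
  by rewrite (le_trans _ (ltW phiK))// (svm_nondecreasing svm)// ltW.
split=> //; have [L xL [M0 ME phiL]] := m_invP xi0 xiB.
have L0 : 0 < L := lt_le_trans x0 xL.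
have KL : K <= L.
  rewrite leNgt; apply/negP => LK; have := svm_nondecreasing svm (ltW L0) (ltW LK).
  by rewrite phiL leNgt phiK.
have := LamK _ KL; rewrite /Lam gtr0_norm// phiL -mulrA -invfM -ME.
by rewrite ler_pM2l// lef_pV2.
Qed.

End moment.

(** * Two-point laws *)

Section two_point.
Context (R : realType).

Definition two_point_val (L : R) (b : bool) : measurableTypeR R :=
  if b then L else 0.

Lemma measurable_two_point_val L : measurable_fun setT (two_point_val L).
Proof. by []. Qed.

HB.instance Definition _ L := isMeasurableFun.Build _ _ _ _
  (two_point_val L) (measurable_two_point_val L).

(** The law [(1 - p) delta_0 + p delta_L], encoded as the image of a coin toss so that its integrals
    reduce to Bernoulli ones. *)
Definition two_point (p L : R) : probability (measurableTypeR R) R :=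
  distribution (bernoulli_prob p) (two_point_val L).

Context (p L : R) (p01 : 0 <= p <= 1).

Lemma ge0_integral_two_point (f : R -> R) : measurable_fun setT f ->
  (forall x, 0 <= f x) ->
  (\int[two_point p L]_x (f x)%:E)%E = (p * f L + (1 - p) * f 0)%:E.
Proof.
move=> mf f0; rewrite /two_point ge0_integral_distribution//; last first.
  exact/measurable_EFinP.
rewrite integral_bernoulli_prob//= => b.
by rewrite lee_fin.
Qed.

(** Only an inequality, since [L = 0] puts all the mass at 0. *)
Lemma two_point_set1_0 : ((1 - p)%:E <= two_point p L [set 0%R])%E.
Proof.
rewrite (_ : (1 - p)%:E = bernoulli_prob p [set false]).
  apply: le_measure; rewrite ?inE//.
  by move=> b /= ->.
by rewrite /bernoulli_prob p01 fsbig_set1.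
Qed.

Lemma integrable_two_point : (two_point p L).-integrable setT (fun x => x%:E).
Proof.
apply/integrableP; split; first exact/measurable_EFinP.
under eq_integral do rewrite abse_EFin.
rewrite ge0_integral_two_point ?ltry//; exact: measurable_normr.
Qed.

Lemma integral_two_point : (\int[two_point p L]_x x%:E = (p * L)%:E)%E.
Proof.
rewrite /two_point integral_distribution//; last first.
  apply/integrableP; split=> //.
  rewrite integral_bernoulli_prob//=.
  by rewrite -!EFinM -EFinD ltry.
(* [L] may be negative: it is factored out by linearity, leaving a nonnegative integrand. *)
have -> : (\int[bernoulli_prob p]_b (EFin \o two_point_val L) b)%E =
    (\int[bernoulli_prob p]_b (L%:E * (b%:R : R)%:E))%E.
  by apply: eq_integral => -[] _ /=; rewrite -EFinM ?mulr1// mulr0.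
rewrite integralZl//.
  rewrite integral_bernoulli_prob//=.
  by rewrite mule1 mule0 adde0 -EFinM mulrC.
apply/integrableP; split=> //.
rewrite integral_bernoulli_prob//=.
by rewrite -!EFinM -EFinD ltry.
Qed.

End two_point.

(** * Errors of an estimator on the null sample *)

Lemma iid_law_nseq (R : realType) (P : probability (measurableTypeR R) R) n
  (A : set (n.-tuple (measurableTypeR R))) (x q : R) : 0 <= q ->
  (q%:E <= P [set x])%E -> measurable A -> A [tuple of nseq n x] ->
  ((q ^+ n)%:E <= iid_law P n A)%E.
Proof.
move=> q0 qP mA Ax.
apply: (@le_trans _ _ (P [set x] ^+ n)%E).
  rewrite EFin_expe; elim: n {A mA Ax} => // n IH.
  by rewrite !expeS lee_pmul// ?expe_ge0 ?lee_fin.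
(* The constant tuple is a box with all sides [[set x]], so [iid_law_rect] gives its mass. *)
have -> : (P [set x] ^+ n)%E = iid_law P n [set t | forall i, [set x] (tnth t i)].
  have -> := @iid_law_rect _ _ _ P n (fun=> [set x]) (fun=> measurable_set1 x).
  by rewrite big_const card_ord iter_mule mule1.
apply: le_measure; rewrite ?inE//.
  have -> : [set t : n.-tuple (measurableTypeR R) | forall i, tnth t i = x] =
      \bigcap_(i in [set: 'I_n]) ((@tnth _ (measurableTypeR R))^~ i @^-1` [set x]).
    by apply/seteqP; split => t /= h i; [move=> _|]; apply: h.
  apply: fin_bigcap_measurable => // i _.
  by rewrite -[X in measurable X]setTI; exact: measurable_tnth.
move=> t /= tx; suff -> : t = [tuple of nseq n x] by [].
by apply: eq_from_tnth => i; rewrite tx tnth_nseq.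
Qed.

Lemma two_point_moment_class (R : realType) (phi : R -> R) (B x_inf p L : R) :
  slowly_varying_moment phi B x_inf -> 0 <= p <= 1 ->
  phi (p * L) = 0 -> p * phi L <= B ->
  moment_class phi B (p * L) (two_point p L).
Proof.
move=> svm p01 phi_mean phiL; have /andP[p0 p1] := p01.
have phi_abs x : phi `|x| = phi x.
  by have [_|_] := ger0P x; rewrite ?(svm_even svm).
split; [exact: integrable_two_point|exact: integral_two_point|].
rewrite ge0_integral_two_point//; first last.
- by move=> x; exact: svm_ge0 svm _.
- apply: continuous_measurable_fun => x; apply: continuous_comp.
    by apply: cvgB => //; exact: cvg_cst.
  exact: svm_continuous svm _.
(* The atom at 0 contributes [phi (- (p * L)) = 0]; the atom at [L] contributes at most [p * phi L],
   because [L - p * L] is no larger than [L] in absolute value. *)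
rewrite lee_fin sub0r (svm_even svm) phi_mean mulr0 addr0 (le_trans _ phiL)//.
rewrite ler_wpM2l// -phi_abs -[phi L]phi_abs (svm_nondecreasing svm)//.
have -> : L - p * L = (1 - p) * L by ring.
by rewrite normrM ler_piMl// ger0_norm; lra.
Qed.

Lemma two_point_lower_bound (R : realType) (phi : R -> R)
  (B x_inf beta Delta p L : R) n (est : n.-tuple (measurableTypeR R) -> R) :
  slowly_varying_moment phi B x_inf -> measurable_fun setT est ->
  (confidence_level phi B est Delta <= beta%:E)%E ->
  0 <= p <= 1 -> Delta < p * L -> phi (p * L) = 0 -> p * phi L <= B ->
  (1 - p) ^+ n <= beta.
Proof.
move=> svm mest; rewrite /confidence_level ge_max => /andP[lev_gt lev_lt].
move=> p01 DpL phi_mean phiL; have /andP[p0 p1] := p01.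
have q0 : 0 <= 1 - p by rewrite subr_ge0.
rewrite -lee_fin.
(* The two laws with means [- p * L] and [p * L] both give mass at least
   [(1 - p) ^+ n] to the null sample, on which the estimator errs by more than
   [Delta] for one of them. *)
have [est0|est0] := lerP 0 (est [tuple of nseq n 0]).
- have mc : moment_class phi B (p * - L) (two_point p (- L)).
    by apply: (two_point_moment_class svm) => //; rewrite ?mulrN (svm_even svm).
  apply: le_trans lev_gt; apply: (@le_trans _ _
      (iid_law (two_point p (- L)) n [set x | p * - L + Delta < est x])).
    apply: (@iid_law_nseq _ _ _ _ 0) => //.
    + exact: two_point_set1_0.
    + have := mest measurableT _ (measurable_itv `](p * - L + Delta), +oo[).
      by rewrite setTI set_itvE.
    + by rewrite /= (lt_le_trans _ est0)// mulrN addrC subr_lt0.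
  by apply: ereal_sup_ubound; exists (p * - L), (two_point p (- L)).
- have mc := two_point_moment_class svm p01 phi_mean phiL.
  apply: le_trans lev_lt; apply: (@le_trans _ _
      (iid_law (two_point p L) n [set x | est x < p * L - Delta])).
    apply: (@iid_law_nseq _ _ _ _ 0) => //.
    + exact: two_point_set1_0.
    + have := mest measurableT _ (measurable_itv `]-oo, (p * L - Delta)[).
      by rewrite setTI set_itvE.
    + by rewrite /= (lt_trans est0)// subr_gt0.
  by apply: ereal_sup_ubound; exists (p * L), (two_point p L).
Qed.

(** * Asymptotics and conclusion *)

Lemma expR_lt_onemX (R : realType) (p xi : R) n : (0 < n)%N -> p < 1 ->
  p < xi * (1 - p) -> expR (- (n%:R * xi)) < (1 - p) ^+ n.
Proof.
move=> n0 p1 pxi; have q0 : 0 < 1 - p by rewrite subr_gt0.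
rewrite -mulrN expRM_natl ltrXn2r ?expR_ge0 ?gt_eqF ?ltW//.
rewrite expRN -[ltRHS]invrK ltf_pV2 ?posrE ?expR_gt0 ?invr_gt0//.
(* Now [1 + t <= expR t] applies with [t = p / (1 - p)], and [t < xi] by hypothesis. *)
have -> : (1 - p)^-1 = 1 + p / (1 - p) by field; rewrite gt_eqF.
by rewrite (le_lt_trans (expR_ge1Dx _))// ltr_expR ltr_pdivrMr.
Qed.

Lemma limn_einf_ge (R : realType) (u : nat -> \bar R) (l : \bar R) :
  (\forall n \near \oo, (l <= u n)%E) -> (l <= limn_einf u)%E.
Proof.
move=> [N _ lu]; rewrite limn_einf_lim; apply: lime_ge; first exact: is_cvg_einfs.
exists N => // n /= Nn; apply: le_ereal_inf_tmp => _ [k /= nk <-].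
by apply: lu; exact: leq_trans nk.
Qed.

Theorem corollary6 (R : realType) (phi : R -> R) (B x_inf beta : R)
  (Delta : nat -> R)
  (est : forall n : nat, n.-tuple (measurableTypeR R) -> R) :
  slowly_varying_moment phi B x_inf ->
  0 < beta < 1 / 2 ->
  (forall n : nat, (0 < n)%N -> 0 < Delta n) ->
  (forall n : nat, (0 < n)%N -> measurable_fun setT (est n)) ->
  (forall n : nat, (0 < n)%N ->
    (confidence_level phi B (est n) (Delta n) <= beta%:E)%E) ->
  let xi := fun n : nat => ln (1 / beta) / n%:R in
  (1%:E <= limn_einf (fun n : nat => (Delta n / m_inv phi B x_inf (xi n))%:E))%E.
Proof.
move=> svm /andP[beta0 beta_lt] Delta0 mest level.
pose xi (n : nat) : R := ln (1 / beta) / n%:R.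
change (is_true
  (1%:E <= limn_einf (fun n => (Delta n / m_inv phi B x_inf (xi n))%:E))%E).
have x_inf0 := x_inf_gt0 svm.
have ln0 : 0 < ln (1 / beta) by rewrite ln_gt0// ltr_pdivlMr//; lra.
have xi_cvg0 : xi n @[n --> \oo] --> 0.
  rewrite -(mulr0 (ln (1 / beta))); apply: cvgM; first exact: cvg_cst.
  apply/(gtr0_cvgV0 _); last exact: cvgr_idn.
  by exists 1%N => // n /= n1; rewrite ltr0n.
have xi_lt s : 0 < s -> \forall k \near \oo, xi k < s.
  by move=> s0; exact: cvgr_lt xi_cvg0 _ s0.
have [x0 x0_gt0 phi0] := svm_flat svm.
have [d d0 m_inv_le] := m_inv_eventually_le svm x0_gt0.
apply/lee_subgt0Pr => e e0; rewrite -EFinB.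
apply: limn_einf_ge; near=> n.
have n0 : (0 < n)%N by near: n; exists 1%N.
have xi0 : 0 < xi n by rewrite divr_gt0// ltr0n.
have xid : xi n < d by near: n; exact: xi_lt.
have xie : xi n < e by near: n; exact: xi_lt.
have xi1 : xi n < 1 by near: n; exact: xi_lt.
have [|xiB M_le] := m_inv_le (xi n); first by rewrite xi0.
have [L xL [M0 ME phiL]] := m_invP svm xi0 xiB.
have L0 : 0 < L := lt_le_trans x_inf0 xL.
rewrite lee_fin leNgt ltr_pdivrMr//; apply/negP => Delta_lt.
(* [e] is an arbitrary positive real; [0 < Delta n < (1 - e) * M] rules out [e >= 1]. *)
have e1 : 0 < 1 - e.
  by rewrite -(pmulr_lgt0 _ M0) (lt_trans _ Delta_lt)// Delta0.
pose p := (1 - e) * xi n.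
have pL : p * L = (1 - e) * m_inv phi B x_inf (xi n) by rewrite ME mulrA.
have p0 : 0 <= p by rewrite mulr_ge0// ltW.
(* This amounts to [p < e], which follows from [p < xi n < e]. *)
have pxi : p < xi n * (1 - p).
  by rewrite mulrC ltr_pM2r// /p; nra.
have p1 : p < 1 by rewrite /p; nra.
have : (1 - p) ^+ n <= beta.
  apply: (@two_point_lower_bound _ phi B x_inf beta (Delta n) p L n (est n)) => //.
  - exact: mest.
  - exact: level.
  - by rewrite p0 ltW.
  - by rewrite pL.
  (* The mean is at most [M <= x0], inside the flat zone of [phi]. *)
  - apply: phi0; rewrite pL ger0_norm; last by rewrite mulr_ge0 ?ltW.
    by rewrite (le_trans _ M_le)// ler_piMl ?ltW//; lra.
  - rewrite phiL /p -mulrA [xi n * _]mulrC divfK ?gt_eqF//.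
    by rewrite ler_piMl ?(ltW (svm_B_gt0 svm))//; lra.
have := expR_lt_onemX n0 p1 pxi.
(* Since [n * xi n = ln (1 / beta)], the exponential is exactly [beta]. *)
rewrite /xi [n%:R * _]mulrC divfK ?pnatr_eq0 -?lt0n// div1r lnV ?posrE// opprK.
by rewrite lnK ?posrE// ltNge => /negbTE ->.
Unshelve. all: by end_near. Qed.
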